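(* Let $X_1, X_2, \ldots$ be a stationary sequence of real-valued random variables on a probability space with probability measure $\mathbf{P}$ and expectation $\mathbf{E}$, and write $S_n := X_1 + \cdots + X_n$ for every $n \in \mathbf{N}$. If $\mathbf{E} X_1 > 0$, then \[ \mathbf{P}(S_n > 0 \text{ for all } n \in \mathbf{N}) > 0. \]
   Context: $\mathbf{N} = \{1,2,3,\ldots\}$. A sequence $X_1, X_2, \ldots$ of random variables is stationary if for every $k \in \mathbf{N}$ the sequence $(X_{k+1}, X_{k+2}, \ldots)$ has the same joint distribution as $(X_1, X_2, \ldots)$. The hypothesis $\mathbf{E} X_1 > 0$ means that the expectation of $X_1$ is well-defined (at least one of $\mathbf{E}[\max(X_1,0)]$, $\mathbf{E}[\max(-X_1,0)]$ is finite) and is positive, the value $+\infty$ being allowed. *)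

(* Defs.v *)
From HB Require Import structures.
From mathcomp Require Import all_boot all_order all_algebra.
From mathcomp Require Import all_classical all_reals all_analysis.

Set Implicit Arguments.
Unset Strict Implicit.
Unset Printing Implicit Defensive.

Import Order.TTheory GRing.Theory Num.Theory.
Import numFieldNormedType.Exports.

Local Open Scope classical_set_scope.
Local Open Scope ring_scope.

Definition coordinate_sets (R : realType) : set (set (nat -> R)) :=
  \bigcup_(n : nat)
    preimage_set_system [set: nat -> R] (fun x : nat -> R => x n) measurable.

(* R^N with the product of the Borel sigma-algebras *)
Definition seq_space (R : realType) := g_sigma_algebraType (@coordinate_sets R).

Definition joint (d : measure_display) (T : measurableType d) (R : realType)
    (P : probability T R) (X : nat -> {RV P >-> R}) : T -> seq_space R :=
  fun w n => X n w.

Lemma measurable_joint (d : measure_display) (T : measurableType d)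
    (R : realType) (P : probability T R) (X : nat -> {RV P >-> R}) :
  measurable_fun [set: T] (joint X).
Proof.
apply: measurability; first by [].
move=> _ [A [n _ [B mB <-]] <-].
rewrite [X in measurable X](_ : _ = [set: T] `&` X n @^-1` B); last first.
  by rewrite !setTI.
exact: measurable_funPT.
Qed.

HB.instance Definition _ (d : measure_display) (T : measurableType d)
    (R : realType) (P : probability T R) (X : nat -> {RV P >-> R}) :=
  isMeasurableFun.Build _ _ T (seq_space R) (joint X) (measurable_joint X).

(* Two laws are compared on measurable sets only: a library measure is a
   function on all sets, its values elsewhere being irrelevant. *)
Definition same_joint_distribution (d : measure_display) (T : measurableType d)
    (R : realType) (P : probability T R) (X Y : nat -> {RV P >-> R}) : Prop :=
  forall A : set (seq_space R), measurable A ->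
    distribution P (joint X) A = distribution P (joint Y) A.

(* Sequences are indexed from 0: the term X_(n+1) of the usual numbering
   is [X n], so (X_(k+1), X_(k+2), ...) is [fun n => X (k + n)]. *)
Definition stationary (d : measure_display) (T : measurableType d)
    (R : realType) (P : probability T R) (X : nat -> {RV P >-> R}) : Prop :=
  forall k : nat, (0 < k)%N ->
    same_joint_distribution (fun n => X (k + n)%N) X.

(* ['E_P[Y]] is a total function, with junk value -oo when both the positive
   and the negative part have infinite expectation. *)
Definition expectation_defined (d : measure_display) (T : measurableType d)
    (R : realType) (P : probability T R) (Y : {RV P >-> R}) : Prop :=
  ('E_P[Y^\+] < +oo \/ 'E_P[Y^\-] < +oo)%E.

(* [partial_sum X n] is the sum of the first n terms, S_n = X_1 + ... + X_n. *)
Definition partial_sum (d : measure_display) (T : measurableType d)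
    (R : realType) (P : probability T R) (X : nat -> {RV P >-> R})
    (n : nat) (w : T) : R :=
  \sum_(i < n) X i w.

(* Main.v *)
Require Import Defs.
From mathcomp Require Import all_boot all_order all_algebra.
From mathcomp Require Import all_classical all_reals all_analysis.
From mathcomp Require Import measurable_realfun lra.

Set Implicit Arguments.
Unset Strict Implicit.
Unset Printing Implicit Defensive.

Import Order.TTheory GRing.Theory Num.Theory.
Import numFieldNormedType.Exports.

Local Open Scope classical_set_scope.
Local Open Scope ring_scope.

(** The argument is by contraposition, along Garsia's proof of the maximal
    ergodic theorem. For a real sequence [x] let
    [depth n x = max_(0 <= k <= n) - (x_0 + ... + x_(k-1))], the depth below 0
    reached by the first [n] partial sums. Starting the sums one term later
    gives [depth n.+1 x = max 0 (depth n (shift x) - x_0)], and the inner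
    quantity [depth n (shift x) - x_0] is nonnegative exactly when one of the
    first [n+1] nonempty partial sums is [<= 0]; call this the event [A_n].
    Since the depth increases with [n], this yields pointwise
    [[
       x_0 1_(A_n) + depth n x <= depth n (shift x)
    ]]
    ([depth_shift_ge] on [A_n]; [depth_shift_lt] outside, where
    [depth n x = 0]). For a stationary sequence with [E X_0^- < +oo] both
    depths have the same finite expectation, so they cancel and
    [E (X_0^+ 1_(A_n)) <= E X_0^-] ([integral_ruin_event_le]). If almost surely
    some [S_n] is [<= 0], the increasing events [A_n] exhaust the space up to a
    null set, and monotone convergence gives [E X_0^+ <= E X_0^-], that is
    [E X_0 <= 0] ([expectation_le0]). *)

(** * Depth of the partial sums of a real sequence *)

Definition shift (R : realType) (x : seq_space R) : seq_space R :=
  fun i => x i.+1.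

(** This is [max_(0 <= k <= n) - (x_0 + ... + x_(k-1))], the term [k = 0] being
    the empty sum. The recursion on the shifted sequence, instead of a maximum
    over [k], is the identity on which the pathwise inequality rests. *)
Fixpoint depth (R : realType) (n : nat) (x : seq_space R) : R :=
  if n is m.+1 then Num.max 0 (depth m (shift x) - x 0%N) else 0.

Section Pathwise.
Context (R : realType).
Implicit Types (x : seq_space R) (n : nat).

Lemma depth_ge0 n x : 0 <= depth n x.
Proof. by case: n => [|n] //=; rewrite le_max lexx. Qed.

Lemma depth_leS n x : depth n x <= depth n.+1 x.
Proof.
elim: n x => [|n IHn] x; first exact: depth_ge0.
have := IHn (shift x); rewrite [depth n.+2 x]/= [depth n.+1 x]/= => le_n.
by rewrite ge_max le_max lexx /= le_max lerD2r le_n orbT.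
Qed.

Lemma depth_homo x : {homo (fun n => depth n x) : m n / (m <= n)%N >-> m <= n}.
Proof. by apply: homo_leq => [//|? ? ?|n]; [exact: le_trans|exact: depth_leS]. Qed.

(** Used to place every path with a nonpositive partial sum in some
    [ruin_event]. *)
Lemma opp_sum_le_depth n x : - (\sum_(i < n) x i) <= depth n x.
Proof.
elim: n x => [|n IHn] x; first by rewrite big_ord0 oppr0.
rewrite big_ord_recl opprD addrC /= le_max; apply/orP; right.
by rewrite lerD2r; exact: IHn (shift x).
Qed.

(** When [x 0 <= depth n (shift x)] the outer maximum with 0 in the recursion
    is attained by its second argument, so that
    [x 0 + depth n.+1 x = depth n (shift x)]; then use [depth_leS]. *)
Lemma depth_shift_ge n x : x 0%N <= depth n (shift x) ->
  x 0%N + depth n x <= depth n (shift x).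
Proof.
move=> x0_le; rewrite addrC -lerBrDr; apply: le_trans (depth_leS n x) _.
by rewrite /= ge_max lexx andbT subr_ge0.
Qed.

(** In the opposite case the maximum with 0 is attained by 0, so even
    [depth n.+1 x] vanishes. *)
Lemma depth_shift_lt n x : depth n (shift x) < x 0%N -> depth n x = 0.
Proof.
move=> lt_x0; apply/eqP; rewrite eq_le depth_ge0 andbT.
apply: le_trans (depth_leS n x) _.
by rewrite /= ge_max lexx subr_le0 ltW.
Qed.

End Pathwise.

(** * Measurability on the sequence space *)

Section Measurability.
Context (R : realType).

Lemma measurable_coordinate n :
  measurable_fun [set: seq_space R] (fun x : seq_space R => x n).
Proof.
move=> _ B mB; apply: sub_sigma_algebra.
by exists n => //; exists B.
Qed.

Lemma measurable_shift : measurable_fun [set: seq_space R] (@shift R).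
Proof.
apply: measurability; first by [].
move=> _ [A [n _ [B mB <-]] <-].
rewrite !setTI.
have := @measurable_coordinate n.+1 measurableT B mB.
by rewrite setTI.
Qed.

Lemma measurable_depth n : measurable_fun [set: seq_space R] (depth n).
Proof.
elim: n => [|n IHn]; first exact: measurable_cst.
apply: measurable_maxr => //.
apply: measurable_funB; last exact: measurable_coordinate.
exact: measurableT_comp IHn measurable_shift.
Qed.

End Measurability.

(** * The maximal inequality for a stationary sequence *)

Section StationarySequence.
Context (d : measure_display) (T : measurableType d) (R : realType).
Context (P : probability T R) (X : nat -> {RV P >-> R}).
Local Notation X0 := (X 0%N : T -> R).
Context (stationary_X : stationary X).

(** Invariance under one shift is all that the proof takes from stationarity:
    both integrals only depend on the law of a sequence on measurable sets. *)
Lemma integral_shift (f : seq_space R -> \bar R) :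
  measurable_fun [set: seq_space R] f -> (forall x, 0 <= f x)%E ->
  (\int[P]_w f (shift (joint X w)) = \int[P]_w f (joint X w))%E.
Proof.
move=> mf f0.
pose Y := fun n => X (1 + n)%N.
have law (Z : nat -> {RV P >-> R}) :
    (\int[P]_w f (joint Z w) = \int[distribution P (joint Z)]_x f x)%E.
  by rewrite ge0_integral_pushforward // => x _; exact: f0.
rewrite (law X) -[LHS]/(\int[P]_w f (joint Y w))%E law.
apply: eq_measure_integral => A mA _; exact: stationary_X.
Qed.

Lemma measurable_depth_joint n :
  measurable_fun [set: T] (fun w => depth n (joint X w)).
Proof. exact: measurableT_comp (measurable_depth n) (measurable_joint X). Qed.

Lemma measurable_depth_shift n :
  measurable_fun [set: T] (fun w => depth n (shift (joint X w))).
Proof.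
have mS := measurableT_comp (@measurable_shift R) (measurable_joint X).
exact: measurableT_comp (measurable_depth n) mS.
Qed.

Lemma integral_depth_shift n :
  (\int[P]_w (depth n (shift (joint X w)))%:E =
   \int[P]_w (depth n (joint X w))%:E)%E.
Proof.
apply: (@integral_shift (fun x => (depth n x)%:E)).
  by apply/measurable_EFinP; exact: measurable_depth.
by move=> x; rewrite lee_fin depth_ge0.
Qed.

Context (X0neg_fin : (\int[P]_w (X0 ^\- w)%:E < +oo)%E).

Let measurable_pos : measurable_fun [set: T] (EFin \o X0 ^\+).
Proof. by apply/measurable_EFinP/measurable_funrpos; exact: measurable_funPT. Qed.

Let measurable_neg : measurable_fun [set: T] (EFin \o X0 ^\-).
Proof. by apply/measurable_EFinP/measurable_funrneg; exact: measurable_funPT. Qed.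

(** This finiteness lets the integrals of the two depths be cancelled. By the
    recursion, [depth n.+1] exceeds the depth [depth n] of the shifted sequence
    by at most [X_0^-], and the shift leaves the integral unchanged; hence
    [n] steps cost at most [n] times the integral of [X_0^-]. *)
Lemma integral_depth_lty n :
  (\int[P]_w (depth n (joint X w))%:E < +oo)%E.
Proof.
elim: n => [|n IHn]; first by rewrite integral0.
apply: (@le_lt_trans _ _ (\int[P]_w ((depth n (shift (joint X w)))%:E +
    (X0 ^\- w)%:E))%E).
  apply: ge0_le_integral => //.
  - by move=> w _; rewrite lee_fin depth_ge0.
  - by apply/measurable_EFinP; exact: measurable_depth_joint.
  - apply: emeasurable_funD => //.
    by apply/measurable_EFinP; exact: measurable_depth_shift.
  move=> w _; rewrite -EFinD lee_fin /= ge_max; apply/andP; split.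
    by rewrite addr_ge0 ?depth_ge0 ?funrneg_ge0.
  by rewrite lerD2l /funrneg le_max lexx.
rewrite ge0_integralD //.
- by rewrite integral_depth_shift lte_add_pinfty.
- by move=> w _; rewrite lee_fin depth_ge0.
- by apply/measurable_EFinP; exact: measurable_depth_shift.
by move=> w _; rewrite lee_fin funrneg_ge0.
Qed.

(** The event that one of [S_1, ..., S_(n+1)] is nonpositive, expressed by the
    case distinction of [depth_shift_ge] and [depth_shift_lt]. *)
Definition ruin_event n : set T :=
  [set w | X 0%N w <= depth n (shift (joint X w))].

Lemma measurable_ruin_event n : measurable (ruin_event n).
Proof.
rewrite -[ruin_event n]setTI.
by apply: measurable_fun_le => //; exact: measurable_depth_shift.
Qed.

(** Integrating [depth_shift_ge], in the form
    [X_0^+ 1_A + depth n <= depth n \o shift + X_0^-] where all four terms are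
    nonnegative: the two integrals of the depth are equal by stationarity and
    finite, so they cancel. *)
Lemma integral_ruin_event_le n :
  (\int[P]_(w in ruin_event n) (X0 ^\+ w)%:E <= \int[P]_w (X0 ^\- w)%:E)%E.
Proof.
have mA := measurable_ruin_event n.
pose D w := (depth n (joint X w))%:E.
pose DS w := (depth n (shift (joint X w)))%:E.
pose N w := (X0 ^\- w)%:E.
pose F := (EFin \o X0 ^\+) \_ (ruin_event n).
have mD : measurable_fun [set: T] D.
  by apply/measurable_EFinP; exact: measurable_depth_joint.
have mDS : measurable_fun [set: T] DS.
  by apply/measurable_EFinP; exact: measurable_depth_shift.
have mF : measurable_fun [set: T] F.
  by apply/(measurable_restrictT _ mA); exact: measurable_funTS.
have D0 w : [set: T] w -> (0 <= D w)%E by rewrite lee_fin depth_ge0.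
have DS0 w : [set: T] w -> (0 <= DS w)%E by rewrite lee_fin depth_ge0.
have N0 w : [set: T] w -> (0 <= N w)%E by rewrite lee_fin funrneg_ge0.
have F0 w : [set: T] w -> (0 <= F w)%E.
  by rewrite /F patchE; case: ifP => // _ _; rewrite lee_fin funrpos_ge0.
have FD_le w : (F w + D w <= DS w + N w)%E.
  rewrite /F patchE; case: ifPn => [|] /=.
    (* On the event, [X_0 = X_0^+ - X_0^-] turns [depth_shift_ge] into the
       inequality between nonnegative terms. *)
    rewrite inE /ruin_event /= -!EFinD lee_fin => /depth_shift_ge.
    have /(congr1 (fun g => g w)) := funrposBneg X0.
    by rewrite /joint !fctE => /= <-; lra.
  rewrite notin_setE /ruin_event /= => /negP; rewrite -ltNge => /depth_shift_lt.
  by rewrite add0e /D => ->; rewrite adde_ge0 ?DS0 ?N0.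
have D_fin : (\int[P]_w D w)%E \is a fin_num.
  by rewrite ge0_fin_numE ?integral_depth_lty// integral_ge0.
rewrite integral_mkcond -(leeD2rE _ _ D_fin) -ge0_integralD //.
rewrite -integral_depth_shift [leRHS]addeC -ge0_integralD //.
apply: ge0_le_integral => //.
- by move=> w wT; rewrite adde_ge0 ?F0 ?D0.
- exact: emeasurable_funD.
- exact: emeasurable_funD.
Qed.

Lemma ruin_event_homo : {homo ruin_event : m n / (m <= n)%N >-> (m <= n)%O}.
Proof.
move=> m n le_mn; apply/subsetPset => w /= /le_trans; apply.
exact: depth_homo.
Qed.

(** If [S_(n+1) <= 0], then [X_0] is at most the opposite of the sum of the
    following [n] terms, hence at most the depth of the shifted sequence. *)
Lemma ruin_event_cover w :
  ~ (forall n, (0 < n)%N -> 0 < partial_sum X n w) ->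
  (\bigcup_n ruin_event n) w.
Proof.
move/existsNP => [[|n]] /not_implyP [] // _ /negP; rewrite -leNgt => le0.
exists n => //; rewrite /ruin_event /=.
apply: le_trans (opp_sum_le_depth n _).
by move: le0; rewrite /partial_sum big_ord_recl -lerBrDr sub0r.
Qed.

Lemma measurable_positive_path :
  measurable [set w | forall n, (0 < n)%N -> 0 < partial_sum X n w].
Proof.
rewrite (_ : [set w | _] =
    \bigcap_n [set w | 0 < partial_sum X n.+1 w]); last first.
  by apply/seteqP; split => [w pos n _|w pos [|n] // _]; [exact: pos|exact: pos n I].
apply: bigcapT_measurable => n; rewrite -[X in measurable X]setTI.
under eq_set => w do rewrite -lte_fin.
apply: measurable_lte => //; apply/measurable_EFinP.
by apply: measurable_sum => i; exact: measurable_funPT.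
Qed.

(** The contrapositive, under the hypothesis [E X_0^- < +oo] of this section:
    the maximal inequality passes to the union of the increasing ruin events,
    which carries the whole mass. *)
Lemma expectation_le0 :
  P [set w | forall n, (0 < n)%N -> 0 < partial_sum X n w] = 0%E ->
  ('E_P[X 0%N] <= 0)%E.
Proof.
set B := [set w | _] => PB0.
have mB : measurable B by exact: measurable_positive_path.
have mU : measurable (\bigcup_n ruin_event n).
  by apply: bigcup_measurable => n _; exact: measurable_ruin_event.
have pos0 (A : set T) w : A w -> (0 <= (X0 ^\+ w)%:E)%E.
  by rewrite lee_fin funrpos_ge0.
have int_le : (\int[P]_w (X0 ^\+ w)%:E <= \int[P]_w (X0 ^\- w)%:E)%E.
  rewrite (ge0_negligible_integral mB) //; last exact: pos0.
  apply: (@le_trans _ _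
    (\int[P]_(w in \bigcup_n ruin_event n) (X0 ^\+ w)%:E)%E).
    apply: ge0_subset_integral => //.
    - exact: measurableD.
    - exact: measurable_funTS.
    - exact: pos0.
    - by move=> w [_ nBw]; exact: ruin_event_cover.
  have cvg_int := ge0_nondecreasing_set_cvg_integral (mu := P) ruin_event_homo
    measurable_ruin_event (fun n => measurable_funTS measurable_pos)
    (fun n w => @pos0 (ruin_event n) w).
  rewrite -(cvg_lim _ cvg_int) //; apply: lime_le.
    by apply/cvg_ex; eexists; exact: cvg_int.
  by apply: nearW => n; exact: integral_ruin_event_le.
rewrite unlock integralE funerpos funerneg.
rewrite leeBlDr ?add0e // ge0_fin_numE //.
by apply: integral_ge0 => w _; rewrite lee_fin funrneg_ge0.
Qed.

End StationarySequence.

(** * Positivity of the probability *)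

(** With an infinite negative part, the difference of extended reals that
    defines the expectation is [-oo], whatever the positive part. *)
Lemma integral_neg_lty (d : measure_display) (T : measurableType d)
    (R : realType) (P : probability T R) (Y : {RV P >-> R}) :
  (0 < 'E_P[Y])%E -> (\int[P]_w ((Y : T -> R)^\- w)%:E < +oo)%E.
Proof.
rewrite unlock integralE funerpos funerneg => EY_gt0.
rewrite ltey; apply/eqP => int_oo; move: EY_gt0.
by rewrite [X in (_ - X)%E]int_oo addeNy.
Qed.

Theorem lemma1 (d : measure_display) (T : measurableType d) (R : realType)
    (P : probability T R) (X : nat -> {RV P >-> R})
    (stationary_X : stationary X)
    (EX_defined : expectation_defined (X 0%N))
    (EX_gt0 : (0 < 'E_P[X 0%N])%E) :
  (0 < P [set w | forall n : nat, (0 < n)%N -> (0 < partial_sum X n w)%R])%E.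
Proof.
rewrite lt0e measure_ge0 andbT; apply/eqP => P0.
have := expectation_le0 stationary_X (integral_neg_lty EX_gt0) P0.
by rewrite leNgt EX_gt0.
Qed.
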